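(* Let $G$ be a finite group. Then for all proper subgroups $H_1$ and $H_2$ of $G$ one has $|H_1\cup H_2|\leq\frac{3}{4}\,|G|$. Moreover, for proper subgroups $H_1,H_2$ of $G$, the equality $|H_1\cup H_2|=\frac{3}{4}\,|G|$ holds if and only if $H_1$ and $H_2$ are distinct maximal subgroups of $G$ of index $2$. *)

(* Writing x = |H1|/|G| and y = |H2|/|G|, both at most 1/2, the bound
   |H1||H2| = |H1 H2||H1 :&: H2| <= |G||H1 :&: H2| gives
   |H1 :|: H2|/|G| <= x + y - xy = 1 - (1 - x)(1 - y) <= 3/4,
   and equality forces x = y = 1/2.  Conversely, if H1 <> H2 both have index 2,
   their intersection is a proper subgroup of H1, so it has at most |G|/4
   elements. *)
From mathcomp Require Import all_boot all_algebra all_fingroup gseries.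
From mathcomp Require Import maximal zify lra.
Import GRing.Theory Num.Theory.

Lemma proper_leq_half (gT : finGroupType) (G H : {group gT}) :
  H \proper G -> 2 * #|H| <= #|G|.
Proof.
case/andP=> sHG nsGH; rewrite -(Lagrange sHG) mulnC leq_mul2l.
by rewrite indexg_gt1 nsGH orbT.
Qed.

Lemma index2_cardE (gT : finGroupType) (G H : {group gT}) :
  H \subset G -> (#|G : H|%g == 2) = (2 * #|H| == #|G|).
Proof.
by move=> sHG; rewrite -(Lagrange sHG) mulnC eqn_pmul2l // eq_sym.
Qed.

Lemma leq_mul_cardI (gT : finGroupType) (G H K : {group gT}) :
  H \subset G -> K \subset G -> #|H| * #|K| <= #|G| * #|H :&: K|.
Proof.
by move=> sHG sKG; rewrite mul_cardG leq_mul2r subset_leq_card ?orbT ?mul_subG.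
Qed.

Lemma leq_cardU_proper (gT : finGroupType) (G H K : {group gT}) :
  H \proper G -> K \proper G -> 4 * #|H :|: K| <= 3 * #|G|.
Proof.
move=> pH pK.
have := leq_mul_cardI gT G H K (proper_sub pH) (proper_sub pK).
have := cardsUI H K; have := proper_leq_half _ _ _ pH.
have := proper_leq_half _ _ _ pK; have := cardG_gt0 G.
move: #|G| #|H| #|K| #|_ :&: _| #|_ :|: _| => n a b c u n0 hb ha hu hc.
(* Without fractions: [n * u <= n * (a + b) - a * b = n ^ 2 - (n - a) * (n - b)], where both factors
   are at least [n / 2]. *)
nia.
Qed.

Lemma eq_cardU_proper (gT : finGroupType) (G H K : {group gT}) :
  H \proper G -> K \proper G -> 4 * #|H :|: K| = 3 * #|G| ->
  2 * #|H| = #|G| /\ 2 * #|K| = #|G|.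
Proof.
move=> pH pK.
have := leq_mul_cardI gT G H K (proper_sub pH) (proper_sub pK).
have := cardsUI H K; have := proper_leq_half _ _ _ pH.
have := proper_leq_half _ _ _ pK; have := cardG_gt0 G.
move: #|G| #|H| #|K| #|_ :&: _| #|_ :|: _| => n a b c u n0 hb ha hu hc eu.
(* Now [4 * (n - a) * (n - b) <= n ^ 2]; as [n > 0] and each factor is at least [n / 2], both must
   equal [n / 2]. *)
split; nia.
Qed.

Lemma geq_cardU_index2 (gT : finGroupType) (G H K : {group gT}) :
  H :!=: K -> 2 * #|H| = #|G| -> 2 * #|K| = #|G| ->
  3 * #|G| <= 4 * #|H :|: K|.
Proof.
move=> neHK hH hK.
have eHK : #|H| = #|K| by apply/eqP; rewrite -(eqn_pmul2l (m := 2)) // hH hK.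
have pI : H :&: K \proper H.
  rewrite properE subsetIl subsetI subxx /=; apply: contra neHK => sHK.
  by rewrite eqEcard sHK eHK leqnn.
have /= := proper_leq_half _ H (H :&: K)%G pI; have := cardsUI H K.
(* The union has [#|G| - #|H :&: K|] elements, and the intersection at most a quarter of [#|G|]. *)
move: hH hK; move: #|G| #|H| #|K| #|_ :&: _| #|_ :|: _|; lia.
Qed.

Theorem theorem2p1p1 (gT : finGroupType) (G H1 H2 : {group gT})
    (pH1 : H1 \proper G) (pH2 : H2 \proper G) :
  ((#|H1 :|: H2|%:R : rat) <= 3%:R / 4%:R * #|G|%:R)%R /\
  (((#|H1 :|: H2|%:R : rat) = 3%:R / 4%:R * #|G|%:R)%R <->
   [/\ H1 :!=: H2, maximal H1 G, maximal H2 G,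
       #|G : H1|%g = 2 & #|G : H2|%g = 2]).
Proof.
have sH1 := proper_sub pH1; have sH2 := proper_sub pH2.
have leU := leq_cardU_proper _ _ _ _ pH1 pH2.
have eqE : (#|H1 :|: H2|%:R : rat)%R = (3%:R / 4%:R * #|G|%:R)%R <->
           4 * #|H1 :|: H2| = 3 * #|G|.
  split=> [e | /(congr1 (fun n => n%:R : rat)%R)]; last first.
    by rewrite !natrM; lra.
  by apply/eqP; rewrite -(eqr_nat rat) !natrM; apply/eqP; lra.
split.
  by move: leU; rewrite -(ler_nat rat) !natrM; lra.
rewrite eqE; split=> [eU | [neH _ _ i1 i2]].
  have [h1 h2] := eq_cardU_proper _ _ _ _ pH1 pH2 eU.
  have i1 : #|G : H1|%g = 2 by apply/eqP; rewrite index2_cardE // h1.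
  have i2 : #|G : H2|%g = 2 by apply/eqP; rewrite index2_cardE // h2.
  (* Maximality holds because the index 2 is prime. *)
  split=> //; [ | by apply: p_index_maximal; rewrite ?i1 ?i2 ..].
  (* If the subgroups coincided, their union would have only [#|G| / 2] elements. *)
  apply/negP => /eqP eH; move: eU; rewrite eH setUid.
  by have := cardG_gt0 G; lia.
apply/eqP; rewrite eqn_leq leU geq_cardU_index2 //.
  by apply/eqP; rewrite -index2_cardE // i1.
by apply/eqP; rewrite -index2_cardE // i2.
Qed.
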